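(* For any countable ordinal $\alpha$ and natural number $m>0$, the linear order $\mathbb{Z}^{\alpha} m$ is strongly surjective.
   Context: All linear orders are assumed non-empty. A linear order $M$ is strongly surjective if for every linear order $L$ that embeds into $M$ (via an order preserving injection) there is an epimorphism (order preserving surjection) from $M$ onto $L$. For linear orders $L,K$, the product $LK$ is $\sum_{k\in K} L$, i.e. $K$ copies of $L$; $L^\star$ is the reverse of $L$; sums of linear orders are the usual ones ($\sum_{i \in I} L_i$ is $\bigcup_{i\in I}\{i\}\times L_i$ ordered lexicographically). In particular $\mathbb{Z}^\alpha m$ is the sum of $m$ copies of $\mathbb{Z}^\alpha$. For ordinals $\alpha$, $\mathbb{Z}^\alpha$ is defined by induction: $\mathbb{Z}^0=1$; $\mathbb{Z}^{\alpha+1}=\mathbb{Z}^\alpha\omega^\star+\mathbb{Z}^\alpha+\mathbb{Z}^\alpha\omega$; and $\mathbb{Z}^\alpha=\big(\sum_{\beta<\alpha}\mathbb{Z}^\beta\omega\big)^\star+1+\sum_{\beta<\alpha}\mathbb{Z}^\beta\omega$ if $\alpha$ is a limit ordinal. *)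

(* Defs.v *)
From HB Require Import structures.
From mathcomp Require Import all_boot all_order.
From mathcomp Require Import boolp classical_sets cardinality.

Set Implicit Arguments.
Unset Strict Implicit.
Unset Printing Implicit Defensive.

Import Order.Theory.

Local Open Scope order_scope.

(* A linear order is an [orderType]. Such a type may be empty, which is wanted
   for the ordinal 0; the convention that linear orders are non-empty is put
   explicitly in [strongly_surjective]. *)

(* MathComp's [{i : I & L i}] carries the lexicographic order, the index being
   compared first. *)
Definition lsum {d1 d2} (I : orderType d1) (L : I -> orderType d2) :
  orderType d2 := {i : I & L i}.

(* [bool] is ordered by [false < true]. *)
Definition ladd {d} (L K : orderType d) : orderType d :=
  lsum (fun b : bool => if b then K else L).

Definition lmul {d1 d2} (L : orderType d2) (K : orderType d1) : orderType d2 :=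
  lsum (fun _ : K => L).

(* Unlike MathComp's [L^d], [reverse L] keeps the display of [L], so that it can
   be added to other orders with the same display. *)
Definition reverse (T : Type) : Type := T.

Section Reverse.
Context {d : Order.disp_t} (L : orderType d).

Definition reverse_le (x y : reverse L) : bool := (y : L) <= (x : L).

Fact reverse_le_refl : reflexive reverse_le.
Proof. exact: lexx. Qed.

Fact reverse_le_anti : antisymmetric reverse_le.
Proof. by move=> x y /andP[yx xy]; apply/le_anti/andP. Qed.

Fact reverse_le_trans : transitive reverse_le.
Proof. by move=> y x z yx zy; exact: le_trans zy yx. Qed.

Fact reverse_le_total : total reverse_le.
Proof. by move=> x y; exact: le_total. Qed.

HB.instance Definition _ := Choice.copy (reverse L) L.
HB.instance Definition _ := Order.Le_isPOrder.Build d (reverse L)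
  reverse_le_refl reverse_le_anti reverse_le_trans.
HB.instance Definition _ :=
  Order.POrder_isTotal.Build d (reverse L) reverse_le_total.

End Reverse.

Definition lreverse {d} (L : orderType d) : orderType d := reverse L.

Definition embeds {d1 d2} (L : orderType d1) (M : orderType d2) : Prop :=
  exists2 f : L -> M, injective f & {homo f : x y / x <= y}.

Definition epimorphic {d1 d2} (M : orderType d1) (L : orderType d2) : Prop :=
  exists2 g : M -> L, {homo g : x y / x <= y} & forall y, exists x, g x = y.

Definition strongly_surjective {d} (M : orderType d) : Prop :=
  forall (d' : Order.disp_t) (L : orderType d'),
    inhabited L -> embeds L M -> epimorphic M L.

Definition below {d} {A : orderType d} (x : A) : Type := {y : A | y < x}.

Section Below.
Context {d : Order.disp_t} {A : orderType d} (x : A).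
HB.instance Definition _ := SubChoice.on (below x).
HB.instance Definition _ := [SubChoice_isSubOrder of below x by <: with d].
End Below.

(* An ordinal is represented by a well-ordered type. *)
Definition well_ordered {d} (A : orderType d) : Prop :=
  well_founded (fun x y : A => x < y).

Definition is_max {d} {A : orderType d} (m : A) : Prop := forall x, x <= m.

(* The display carried by ['I_1]; one display is needed throughout the
   recursion. *)
Local Notation linorder :=
  (orderType preorder.Order.OrdinalOrder.ord_display).

Definition zpow_succ (L : linorder) : linorder :=
  ladd (ladd (lmul L (nat^d : orderType _)) L) (lmul L nat).

Definition zpow_lim {d} (A : orderType d) (Z : A -> linorder) : linorder :=
  let S := lsum (fun x : A => lmul (Z x) nat) in
  ladd (ladd (lreverse S) 'I_1) S.

(* The ordinals smaller than [A] are the segments [below x] with [x : A]. If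
   [Z x] is the power with exponent [below x], then [zpow_step Z] is the power
   with exponent [A]: that ordinal is zero if [A] is empty, it is the successor
   of [below m] if [A] has a greatest element [m], and otherwise a limit. *)
Definition zpow_step {d} (A : orderType d) (Z : A -> linorder) : linorder :=
  if pselect (inhabited A) then
    match pselect (exists m : A, is_max m) with
    | left exm => zpow_succ (Z (sval (cid exm)))
    | right _ => zpow_lim Z
    end
  else 'I_1.

(* The power with exponent [below x]. *)
Definition zpow_below {d} (A : orderType d) (wfA : well_ordered A) :
    A -> linorder :=
  Fix wfA (fun _ => linorder)
    (fun x Z => zpow_step (fun y : below x => Z (val y) (valP y))).

Definition zpow {d} (A : orderType d) (wfA : well_ordered A) : linorder :=
  zpow_step (zpow_below wfA).

Lemma zpow_belowE {d} (A : orderType d) (wfA : well_ordered A) (x : A) :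
  zpow_below wfA x = zpow_step (fun y : below x => zpow_below wfA (val y)).
Proof.
rewrite /zpow_below Fix_eq // => {}x f g fg; congr zpow_step.
by apply: functional_extensionality_dep => y; exact: fg.
Qed.

Lemma zpow0E {d} (A : orderType d) (wfA : well_ordered A) :
  (A -> False) -> zpow wfA = 'I_1.
Proof.
move=> A0; rewrite /zpow /zpow_step.
by case: (pselect (inhabited A)) => // iA; exfalso; case: iA.
Qed.

Lemma zpow_succE {d} (A : orderType d) (wfA : well_ordered A) (m : A) :
  is_max m -> zpow wfA = zpow_succ (zpow_below wfA m).
Proof.
move=> mP; rewrite /zpow /zpow_step.
case: (pselect (inhabited A)) => [iA|]; last by case.
case: (pselect (exists m : A, is_max m)) => [exm|]; last by case; exists m.
case: cid => /= m' m'P; congr (zpow_succ (zpow_below _ _)).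
by apply/le_anti/andP; split; [exact: mP | exact: m'P].
Qed.

Lemma zpow_limE {d} (A : orderType d) (wfA : well_ordered A) :
  inhabited A -> (forall m : A, ~ is_max m) ->
  zpow wfA = zpow_lim (zpow_below wfA).
Proof.
move=> iA noM; rewrite /zpow /zpow_step.
case: (pselect (inhabited A)) => [iA'|//].
case: (pselect (exists m : A, is_max m)) => [exm|//].
by exfalso; case: exm.
Qed.

(* Main.v *)
Require Import Defs.
From mathcomp Require Import all_boot all_order.
From mathcomp Require Import boolp classical_sets cardinality.
From mathcomp Require Import zify.

(* For [X] a non-empty subset of a countable order, an epimorphism onto [X] is
   glued from epimorphisms onto the intervals of [X] cut out by a cofinal
   sequence to the right of a point of [X] and a coinitial one to its left. An
   interval of [Z^(b+1)] meets finitely many copies of [Z^b], and a bounded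
   interval of [Z^a] with [a] a limit embeds into [Z^b] for some [b < a]; so by
   induction it is covered by finitely many consecutive summands of [Z^a], and
   these can be taken arbitrarily far out. Besides strong surjectivity the
   induction carries that [Z^b] embeds into its reverse, that [Z^b 2] embeds
   into [Z^a] for [b < a], and that the sum of the [Z^b omega] over [b < a]
   embeds into [Z^a]. *)

Set Implicit Arguments.
Unset Strict Implicit.
Unset Printing Implicit Defensive.

Import Order.Theory.
Local Open Scope order_scope.
Local Open Scope classical_set_scope.

(** * Epimorphisms and embeddings relative to subsets *)

Definition covers {d1 d2} {H : orderType d1} {T : orderType d2}
    (D : set H) (X : set T) : Prop :=
  exists g : H -> T, [/\ forall a b, D a -> D b -> a <= b -> g a <= g b,
    forall a, D a -> X (g a) & forall y, X y -> exists2 a, D a & g a = y].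

(** As in [covers], the map is total and only its behaviour on the subset counts, so that no order
    on a subtype has to be formed. *)
Definition embeds_on {d1 d2} {T : orderType d1} (X : set T)
    (U : orderType d2) : Prop :=
  exists f : T -> U, forall a b, X a -> X b -> a < b -> f a < f b.

(** Strong surjectivity seen inside [N]: an order that embeds into [N] is isomorphic to its image, a
    subset of [N]. *)
Definition ssurj {d} (N : orderType d) : Prop :=
  forall X : set N, X !=set0 -> covers [set: N] X.

Section Covers.
Context {d1 d2 d3 : Order.disp_t}.

Lemma embeds_on_sub {T : orderType d1} {N : orderType d2} (X Y : set T) :
  Y `<=` X -> embeds_on X N -> embeds_on Y N.
Proof. by move=> YX [f fP]; exists f => a b /YX Xa /YX Xb; exact: fP. Qed.

Lemma embeds_on_comp {T : orderType d1} {N : orderType d2} {M : orderType d3}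
  (X : set T) : embeds_on X N -> embeds_on [set: N] M -> embeds_on X M.
Proof.
move=> [f fP] [g gP]; exists (g \o f) => a b Xa Xb ab.
by apply: gP => //; exact: fP.
Qed.

(** The epimorphism onto the image of [Y] is pulled back along the embedding, which is injective on
    [Y] and reflects the order there. *)
Lemma ssurj_cov_embeds {N : orderType d1} {T : orderType d2} (Y : set T) :
  ssurj N -> Y !=set0 -> embeds_on Y N -> covers [set: N] Y.
Proof.
move=> sN [y0 Yy0] [f fP].
have [|g [gm gX gs]] := sN (f @` Y); first by exists (f y0), y0.
have /choice[h hP] : forall z, exists y, Y y /\ f y = g z.
  by move=> z; have [y Yy <-] := gX z I; exists y.
exists h; split=> [a b _ _ ab|a _|y Yy].
- have [Ya ha] := hP a; have [Yb hb] := hP b.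
  rewrite leNgt; apply/negP => /(fP _ _ Yb Ya); rewrite ha hb.
  by rewrite ltNge gm.
- by have [] := hP a.
- have [|z _ gz] := gs (f y); first by exists y.
  exists z => //; have [Yz hz] := hP z.
  case: (ltgtP (h z) y) => // /fP; rewrite hz gz ltxx => F.
  + by have := F Yz Yy.
  + by have := F Yy Yz.
Qed.

Lemma cov_comp {H : orderType d1} {N : orderType d2} {T : orderType d3}
  (D : set H) (Y : set T) :
  covers D [set: N] -> covers [set: N] Y -> covers D Y.
Proof.
move=> [v [vm _ vs]] [g [gm gY gs]]; exists (g \o v); split => //=.
- by move=> a b Da Db ab; apply: gm => //; exact: vm.
- by move=> a Da; exact: gY.
- by move=> y /gs[z _ <-]; have [a Da <-] := vs z I; exists a.
Qed.

(** Strictness between [D1] and [D2] makes them disjoint, so the two maps can be pasted; [Y1] and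
    [Y2] are ordered only weakly and may share a point. *)
Lemma cov_cat {H : orderType d1} {T : orderType d2} (D1 D2 D : set H)
    (Y1 Y2 Y : set T) :
  D = D1 `|` D2 -> Y = Y1 `|` Y2 ->
  (forall a b, D1 a -> D2 b -> a < b) ->
  (forall a b, Y1 a -> Y2 b -> a <= b) ->
  covers D1 Y1 -> covers D2 Y2 -> covers D Y.
Proof.
move=> -> -> D12 Y12 [g1 [m1 i1 s1]] [g2 [m2 i2 s2]].
have nD a : D2 a -> ~ D1 a by move=> Da /D12 /(_ Da); rewrite ltxx.
exists (fun a => if `[< D1 a >] then g1 a else g2 a); split.
- move=> a b; case: asboolP => Da; case: asboolP => Db.
  + by move=> _ _; exact: m1.
  + by move=> _ [//|D2b] _; apply: Y12; [exact: i1|exact: i2].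
  + by move=> [//|D2a] _; rewrite leNgt D12.
  + by move=> [//|D2a] [//|D2b]; exact: m2.
- move=> a; case: asboolP => Da; first by left; exact: i1.
  by move=> [//|D2a]; right; exact: i2.
- move=> y [/s1[a Da <-]|/s2[a Da <-]]; exists a; try by [left|right].
  + by case: asboolP.
  + by rewrite asboolF //; exact: nD.
Qed.

(** By convexity a point outside [D] lies below all of [D] or above all of it; it is sent to [lo] or
    [hi] accordingly. *)
Lemma cov_extend {H : orderType d1} {T : orderType d2} (D : set H)
    (Y : set T) (lo hi : T) :
  (forall a b c, D a -> D b -> a <= c -> c <= b -> D c) ->
  Y lo -> Y hi -> (forall y, Y y -> lo <= y <= hi) ->
  covers D Y ->
  exists g : H -> T, [/\ {homo g : a b / a <= b}, forall a, Y (g a) &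
    forall y, Y y -> exists2 a, D a & g a = y].
Proof.
move=> cD Ylo Yhi lh [g [gm gY gs]].
exists (fun c => if `[< D c >] then g c else 
  if `[< exists2 b, D b & c <= b >] then lo else hi); split.
- move=> a b ab; case: (asboolP (D a)) => Da; case: (asboolP (D b)) => Db.
  + exact: gm.
  + case: asboolP => [[e De be]|_]; first by case: Db; exact: (cD a e).
    by have /andP[] := lh _ (gY _ Da).
  + case: asboolP => [_|ua]; last by case: ua; exists b.
    by have /andP[] := lh _ (gY _ Db).
  + case: asboolP => [_|ua]; case: asboolP => [[e De be]|_] //.
      by have /andP[] := lh _ Yhi.
    by case: ua; exists e => //; exact: le_trans be.
- by move=> a; case: asboolP => [/gY//|_]; case: asboolP.
- by move=> y /gs[a Da <-]; exists a => //; case: asboolP.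
Qed.

End Covers.

(** * Reversal, and covering by finitely many consecutive blocks *)

Section ReverseCovers.
Context {d1 d2 : Order.disp_t}.

Lemma cov_reverse (H : orderType d1) (T : orderType d2) (D : set H)
  (X : set T) :
  covers (D : set (lreverse H)) (X : set (lreverse T)) -> covers D X.
Proof.
by move=> [g [gm gX gs]]; exists g; split => // a b Da Db ab; exact: gm.
Qed.

Lemma reverse_cov (H : orderType d1) (T : orderType d2) (D : set H)
  (X : set T) :
  covers D X -> covers (D : set (lreverse H)) (X : set (lreverse T)).
Proof.
by move=> [g [gm gX gs]]; exists g; split => // a b Da Db ab; exact: gm.
Qed.

Lemma ltr_reverse (H : orderType d1) (x y : H) :
  ((x : lreverse H) < (y : lreverse H)) = (y < x).
Proof. by rewrite !lt_def eq_sym. Qed.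

End ReverseCovers.

Lemma ssurj_reverse {d} (N : orderType d) : ssurj N -> ssurj (lreverse N).
Proof. by move=> sN X X0; exact/(reverse_cov (D := setT))/sN. Qed.

Lemma embeds_on_reverse {d1 d2} (T : orderType d1) (X : set T)
    (N : orderType d2) :
  embeds_on X N -> embeds_on (X : set (lreverse T)) (lreverse N).
Proof.
move=> [f fP]; exists f => a b Xa Xb.
by rewrite !ltr_reverse; exact: fP.
Qed.

(* [Y] may meet fewer than [n + 1] fibres of [r]; it is then cut in two at one of
   its points, both parts sharing that point. *)
Lemma cov_blocks {d1 d2 d3} {H : orderType d1} {N : orderType d2}
    {T : orderType d3} (p : H -> nat) (i n c : nat) (Y : set T)
    (r : T -> nat) :
  ssurj N ->
  (forall a b, (p a < p b)%N -> a < b) ->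
  (forall k, (i <= k <= i + n)%N -> covers [set h | p h = k] [set: N]) ->
  Y !=set0 ->
  (forall a b, Y a -> Y b -> a <= b -> (r a <= r b)%N) ->
  (forall a, Y a -> (c <= r a <= c + n)%N) ->
  (forall s, embeds_on (Y `&` [set y | r y = s]) N) ->
  covers [set h | (i <= p h <= i + n)%N] Y.
Proof.
move=> sN pm; elim: n c Y => [|n IH] c Y pN Y0 rm rc rN.
  have -> : [set h | (i <= p h <= i + 0)%N] = [set h | p h = i].
    by apply/seteqP; split=> h /=; lia.
  apply: (cov_comp (N := N)); first by apply: pN; lia.
  apply: ssurj_cov_embeds => //; apply: embeds_on_sub (rN c) => y Yy.
  split=> //=.
  by have := rc _ Yy; lia.
have DE : [set h | (i <= p h <= i + n.+1)%N] =
    [set h | (i <= p h <= i + n)%N] `|` [set h | p h = (i + n.+1)%N].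
  by apply/seteqP; split=> h /=; lia.
have D12 a b : [set h | (i <= p h <= i + n)%N] a ->
    [set h | p h = (i + n.+1)%N] b -> a < b.
  by move=> /= pa pb; apply: pm; lia.
have pN' k : (i <= k <= i + n)%N -> covers [set h | p h = k] [set: N].
  by move=> ?; apply: pN; lia.
have lastN : covers [set h | p h = (i + n.+1)%N] [set: N] by apply: pN; lia.
(* [y1] lies in the last fibre that [Y] meets. The last block is to cover this fibre, the earlier
   blocks the rest. *)
have [y1 [Yy1 y1max]] : exists y, Y y /\ forall z, Y z -> (r z <= r y)%N.
  have ex : exists k, `[< exists2 y, Y y & r y = k >].
    by have [y Yy] := Y0; exists (r y); apply/asboolP; exists y.
  have ub k : `[< exists2 y, Y y & r y = k >] -> (k <= c + n.+1)%N.
    by move=> /asboolP[y /rc + <-]; lia.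
  case: (ex_maxnP ex ub) => k /asboolP[y Yy <-] kmax; exists y; split=> // z Yz.
  by apply: kmax; apply/asboolP; exists z.
have [[y0 [Yy0 y01]]|noy] := pselect (exists y, Y y /\ (r y < r y1)%N).
  apply: (cov_cat (Y1 := Y `&` [set y | (r y < r y1)%N])
    (Y2 := Y `&` [set y | r y = r y1]) DE _ D12).
  - apply/seteqP; split=> y /=; last by tauto.
    by move=> Yy; have := y1max _ Yy; rewrite leq_eqVlt => /orP[/eqP|]; tauto.
  - move=> a b [Ya /= ra] [Yb /= rb]; rewrite leNgt; apply/negP => /ltW.
    by move=> /(rm _ _ Yb Ya); lia.
  - apply: (IH c) => //.
    + by exists y0.
    + by move=> a b [Ya _] [Yb _]; exact: rm.
    + by move=> a [Ya /= ra]; have := rc _ Ya; have := rc _ Yy1; lia.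
    + by move=> s; apply: embeds_on_sub (rN s) => y [[]].
  - by apply: cov_comp lastN _; apply: ssurj_cov_embeds => //; exists y1.
have r1 y : Y y -> r y = r y1.
  move=> Yy; have := y1max _ Yy; case: (ltnP (r y) (r y1)) => //; last by lia.
  by move=> ?; case: noy; exists y.
apply: (cov_cat (Y1 := Y `&` [set y | y <= y1])
  (Y2 := Y `&` [set y | y1 <= y]) DE _ D12).
- apply/seteqP; split=> y /=; last by tauto.
  by move=> Yy; have /orP[] := le_total y y1; [left | right].
- by move=> a b [_ /= ay] [_ /= yb]; exact: le_trans yb.
- apply: (IH (r y1)) => //.
  + by exists y1; split=> /=.
  + by move=> a b [Ya _] [Yb _]; exact: rm.
  + by move=> a [Ya _]; rewrite (r1 a Ya); lia.
  + by move=> s; apply: embeds_on_sub (rN s) => y [[]].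
- apply: cov_comp lastN _; apply: ssurj_cov_embeds => //.
    by exists y1; split=> /=.
  by apply: embeds_on_sub (rN (r y1)) => y [Yy _]; split=> //=; exact: r1.
Qed.

(** * Cofinal sequences and gluing along them *)

Definition ctbl (T : Type) := exists f : T -> nat, injective f.

(** The sequence consists of the running maxima of an enumeration of [X], in which [x] stands at the
    numbers that code no point of [X]. *)
Lemma cofinal_seq {d} {T : orderType d} (X : set T) (x : T) :
  ctbl T -> X x ->
  exists u : nat -> T, [/\ forall k, X (u k), forall k, u k <= u k.+1,
    u 0%N = x & forall y, X y -> exists k, y <= u k].
Proof.
move=> [f fI] Xx.
have /choice[e eP] : forall k, exists y,
    X y /\ forall z, X z -> f z = k -> y = z.
  move=> k; have [[z [Xz fz]]|no] := pselect (exists z, X z /\ f z = k).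
    by exists z; split=> // t _; rewrite -fz => /fI.
  by exists x; split=> // z Xz fz; case: no; exists z.
exists (fix u k := if k is k'.+1 then Order.max (u k') (e k') else x).
split=> //.
- by elim=> //= k IH; rewrite /Order.max; case: ifP => // _; have [] := eP k.
- by move=> k /=; rewrite le_max lexx.
- move=> y Xy; exists (f y).+1; have [_ ey] := eP (f y).
  by rewrite /= (ey y) // le_max lexx orbT.
Qed.

Lemma mono_seq {d} {T : porderType d} (u : nat -> T) :
  (forall k, u k <= u k.+1) -> forall j k, (j <= k)%N -> u j <= u k.
Proof.
move=> um j k /subnK <-; elim: (k - j)%N => [|l IH]; first by rewrite add0n.
by rewrite addSn; exact: le_trans (um _).
Qed.

(* The intervals between consecutive [x k] share their endpoints, so what lies
   between the sets [D] covering them can be sent to these endpoints. *)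
Lemma cov_glue {d1 d2 d3} {H : orderType d1} {I : orderType d2}
    {T : orderType d3} (p : H -> I) (X : set T) (x : nat -> T) :
  {homo p : a b / a <= b} -> I -> ctbl I ->
  (forall k, X (x k)) -> (forall k, x k <= x k.+1) ->
  (forall y, X y -> x 0%N <= y) -> (forall y, X y -> exists k, y <= x k) ->
  (forall i k, exists i' D, [/\ i < i', forall h, D h -> i <= p h < i',
     forall a b c, D a -> D b -> a <= c -> c <= b -> D c &
     covers D (X `&` [set y | x k <= y <= x k.+1])]) ->
  covers [set: H] X.
Proof.
move=> pm i0 cI Xx xm x0 xcof blk.
have [c [_ cm _ ccof]] := @cofinal_seq _ _ [set: I] i0 cI Logic.I.
(* Each local cover is extended to all of [H], with values between its two endpoints; the extensions
   can then be switched at any point. *)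
have {}blk : forall ik : I * nat, exists i'g : I * (H -> T),
    [/\ ik.1 < i'g.1, {homo i'g.2 : a b / a <= b},
      forall h, X (i'g.2 h) /\ x ik.2 <= i'g.2 h <= x ik.2.+1 &
      forall y, X y -> x ik.2 <= y <= x ik.2.+1 ->
        exists2 h, ik.1 <= p h < i'g.1 & i'g.2 h = y].
  move=> [i k]; have [i' [D [ii' Dp Dc]]] := blk i k.
  move=> Dcov; have [|||//|] := @cov_extend _ _ _ _ D
    (X `&` [set y | x k <= y <= x k.+1]) (x k) (x k.+1) Dc.
  - by split; rewrite //= lexx xm.
  - by split; rewrite //= lexx xm.
  - by move=> y [].
  - move=> g [gm gY gs]; exists (i', g); split=> //= y Xy ky.
    by have [|h /Dp ph <-] := gs y; [split | exists h].
have {blk}[F FP] := choice blk.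
(* Block [k] starts at index [J k]. The next start is past the end of this block and at least [c k],
   which makes [J] cofinal in [I]. *)
pose J := fix J k :=
  if k is k'.+1 then Order.max (F (J k', k')).1 (c k') else i0.
have JS k : J k < J k.+1.
  by rewrite /= lt_max; have [-> _ _ _] := FP (J k, k).
have Jm : forall j k, (j <= k)%N -> J j <= J k.
  by apply: mono_seq => k; exact: ltW.
have ex h : exists k, p h < J k.+1.
  have [k hk] := ccof (p h) Logic.I; exists k.+1.
  apply: le_lt_trans hk _; apply: le_lt_trans (JS _).
  by rewrite /= le_max lexx orbT.
(* The map of block [K h] is the one applied to [h]. *)
pose K h := ex_minn (ex h).
have KP h : p h < J (K h).+1 by rewrite /K; case: ex_minnP.
have Kmin h k : p h < J k.+1 -> (K h <= k)%N.
  by rewrite /K; case: ex_minnP => j _; apply.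
pose G k := (F (J k, k)).2.
have xm' := mono_seq xm.
exists (fun h => G (K h) h); split.
- move=> a b _ _ ab.
  have : (K a <= K b)%N.
    by apply: Kmin; exact: le_lt_trans (pm _ _ ab) (KP b).
  rewrite leq_eqVlt => /orP[/eqP->|Kab].
    by have [_ + _ _] := FP (J (K b), K b); apply.
  have [_ _ /(_ a)[_ /andP[_ /= ga]] _] := FP (J (K a), K a).
  have [_ _ /(_ b)[_ /andP[/= gb _]] _] := FP (J (K b), K b).
  by apply: le_trans ga (le_trans _ gb); exact: xm'.
- by move=> h _; have [_ _ /(_ h)[]] := FP (J (K h), K h).
- move=> y Xy.
  have ex' : exists k, y <= x k.+1.
    by have [k yk] := xcof _ Xy; exists k; exact: le_trans (xm _).
  (* By minimality of [k] the point [y] lies between [x k] and [x k.+1]; its preimage in block [k]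
     is then shown to have [K h = k]. *)
  case: (ex_minnP ex') => k yk kmin.
  have xk : x k <= y <= x k.+1.
    rewrite yk andbT; case: k kmin {yk} => [|k] kmin; first exact: x0.
    rewrite leNgt; apply/negP => /ltW /kmin; by rewrite ltnn.
  have [Jlt _ _ /(_ y Xy xk)[h /= /andP[h1 h2] <-]] := FP (J k, k).
  exists h => //; congr (G _ h); apply/eqP; rewrite eqn_leq; apply/andP; split.
    by apply: Kmin; apply: lt_le_trans h2 _; rewrite /= le_max lexx.
  rewrite leqNgt; apply/negP => Kk.
  have := lt_le_trans (KP h) (Jm _ _ Kk).
  by rewrite ltNge h1.
Qed.

(** * Order on lexicographic sums *)

Section LexicographicSum.
Context {d1 d2 : Order.disp_t} {I : orderType d1} {L : I -> orderType d2}.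
Implicit Types s t : lsum L.

Lemma le_lsum_tag s t : s <= t -> tag s <= tag t.
Proof. by rewrite leEsig => /andP[]. Qed.

Lemma lt_lsum_tag s t : tag s < tag t -> s < t.
Proof. by move=> st; rewrite ltEsig (ltW st) leNgt st. Qed.

Lemma lt_lsum_same i (a b : L i) :
  ((existT _ i a : lsum L) < existT _ i b) = (a < b).
Proof. by rewrite ltEsig /= lexx tagged_asE. Qed.

Lemma le_lsum_same i (a b : L i) :
  ((existT _ i a : lsum L) <= existT _ i b) = (a <= b).
Proof. by rewrite leEsig /= lexx tagged_asE. Qed.


Lemma lt_lsumP s t : s < t -> tag s < tag t \/
  exists i (a b : L i), [/\ s = existT _ i a, t = existT _ i b & a < b].
Proof.
case: s t => [i a] [j b] st; have := le_lsum_tag (ltW st).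
rewrite le_eqVlt => /orP[/eqP/= ij|]; last by left.
by subst j; right; exists i, a, b; rewrite lt_lsum_same in st.
Qed.

End LexicographicSum.

(** * Covering to one side of a point, for successor and limit exponents *)

Lemma cov_half_succ {d1 d2 d3} {H : orderType d1} {N : orderType d2}
    {T : orderType d3} (p : H -> nat) (X : set T) (x : T) (r : T -> nat) :
  ssurj N -> {homo p : a b / a <= b >-> (a <= b)%N} ->
  (forall k, covers [set h | p h = k] [set: N]) ->
  ctbl T -> X x -> (forall y, X y -> x <= y) ->
  (forall a b, X a -> X b -> a <= b -> (r a <= r b)%N) ->
  (forall s, embeds_on (X `&` [set y | r y = s]) N) ->
  covers [set: H] X.
Proof.
move=> sN pm pN cT Xx xmin rm rN.
have [u [Xu um u0 ucof]] := cofinal_seq cT Xx.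
apply: (@cov_glue _ _ _ H nat T p X u) => //; first exact: 0%N.
- by exists id.
- by rewrite u0.
(* The interval from [u k] to [u k.+1] meets at most [n + 1] fibres of [r], so the [n + 1] blocks
   from number [i] on suffice. *)
move=> i k; set n := (r (u k.+1) - r (u k))%N.
have rk : (r (u k) <= r (u k.+1))%N by apply: rm.
exists (i + n).+1, [set h | (i <= p h <= i + n)%N]; split.
- by rewrite ltEnat /=; lia.
- by move=> h /=; rewrite leEnat ltEnat.
- by move=> a b c /= pa pb /pm ac /pm cb; lia.
apply: (cov_blocks (N := N) (c := r (u k)) (r := r)) => //.
- by move=> a b; rewrite ltnNge ltNge => /negP ab; apply/negP => /pm.
- by exists (u k); split; rewrite //= lexx um.
- by move=> a b [Xa _] [Xb _]; exact: rm.
- move=> a [Xa /= /andP[ka ak]]; have := rm _ _ (Xu _) Xa ka.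
  by have := rm _ _ Xa (Xu _) ak; lia.
- by move=> s; apply: embeds_on_sub (rN s) => y [[]].
Qed.

Local Notation linorder :=
  (orderType preorder.Order.OrdinalOrder.ord_display).

(* The half of [zpow_lim Z] to the right of its centre. *)
Definition Qsum {d} (A : orderType d) (Z : A -> linorder) : linorder :=
  lsum (fun x : A => lmul (Z x) nat).

(** An interval of [X] between two of its points needs a single copy of some [Z y], and [y] can be
    raised beyond any index because the [Z y] embed upwards. *)
Lemma cov_half_lim {d1 d2} {A : orderType d1} (Z : A -> linorder)
    {T : orderType d2} (X : set T) (x : T) :
  (forall y, ssurj (Z y)) -> (forall y : A, exists y', y < y') ->
  (forall y y' : A, y < y' -> embeds_on [set: Z y] (Z y')) ->
  A -> ctbl A -> ctbl T -> X x -> (forall y, X y -> x <= y) ->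
  (forall a b, X a -> X b ->
    exists y, embeds_on (X `&` [set z | a <= z <= b]) (Z y)) ->
  covers [set: Qsum Z] X.
Proof.
move=> sZ noM eZ a0 cA cT Xx xmin eX.
have [u [Xu um u0 ucof]] := cofinal_seq cT Xx.
apply: (@cov_glue _ _ _ (Qsum Z) A T (@tag _ _) X u) => //.
- by move=> s t; exact: le_lsum_tag.
- by rewrite u0.
move=> i k.
have [y eY] : exists y, i <= y /\
    embeds_on (X `&` [set z | u k <= z <= u k.+1]) (Z y).
  have [y ey] := eX _ _ (Xu k) (Xu k.+1).
  case: (leP i y) => iy; first by exists y.
  by exists i; split => //; apply: embeds_on_comp ey _; exact: eZ.
case: eY => iy eY; have [i' yi'] := noM y.
(* Copy 0 of [Z y] is used. As the first copy in its summand, it is convex as soon as it is bounded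
   above correctly. *)
exists i', [set s | tag s = y /\ tag (tagged s) = 0%N]; split.
- exact: le_lt_trans yi'.
- by move=> s /= [sy _]; move: (tag s) sy => _ ->; rewrite iy yi'.
- move=> [ya [na za]] [yb [nb zb]] [yc [nc zc]] /= [yay _] [yby nb0] ac cb.
  have yca : yc = y.
    by apply/le_anti; rewrite -{2}yay (le_lsum_tag ac) -yby (le_lsum_tag cb).
  subst yb yc; split=> //; move: cb; rewrite le_lsum_same => /le_lsum_tag /=.
  by rewrite nb0 leEnat leqn0 => /eqP.
apply: (cov_comp (N := Z y)); last first.
  apply: ssurj_cov_embeds => //.
  by exists (u k); split; rewrite //= lexx um.
have [z0 _] : [set: Z y] !=set0.
  by case: eY => f _; exists (f (u k)).
(* [c] only fixes the index: [tagged_as c s] reads the component of [s] in the summand at [y], and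
   is the component of [c] if [s] lies elsewhere. *)
pose c : Qsum Z := existT _ y (existT _ 0%N z0).
exists (fun s => tagged (tagged_as c s)); split=> //.
- move=> [ya [na za]] [yb [nb zb]] /= [ey ea] [ey' eb]; subst ya yb na nb.
  by rewrite !tagged_asE !le_lsum_same.
- move=> z _; exists (existT _ y (existT _ 0%N z)) => //=.
  by rewrite tagged_asE.
Qed.

(** * Sums of a lower, a middle and an upper order *)

Section ThreeSummands.
Context {d : Order.disp_t} (Lo Mid Up : orderType d).

Notation tri := (ladd (ladd Lo Mid) Up).

Definition tlo (a : Lo) : tri :=
  existT (fun b : bool => if b then Up else ladd Lo Mid) false
    (existT (fun b : bool => if b then Mid else Lo) false a).
Definition tmid (a : Mid) : tri :=
  existT (fun b : bool => if b then Up else ladd Lo Mid) false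
    (existT (fun b : bool => if b then Mid else Lo) true a).
Definition tup (a : Up) : tri :=
  existT (fun b : bool => if b then Up else ladd Lo Mid) true a.

Variant tri_spec : tri -> Type :=
  | TriLo a : tri_spec (tlo a)
  | TriMid a : tri_spec (tmid a)
  | TriUp a : tri_spec (tup a).

(** The proof is transparent so that [tri_elim] computes on each of the three injections. *)
Lemma triP w : tri_spec w.
Proof.
case: w => [[] u]; first exact: (TriUp u).
by case: u => [[] u]; [exact: (TriMid u) | exact: (TriLo u)].
Defined.

Definition tri_elim {U : Type} (f : Lo -> U) (g : Mid -> U) (h : Up -> U)
    (w : tri) : U :=
  match triP w with TriLo a => f a | TriMid a => g a | TriUp a => h a end.

Lemma tri_elim_lo U f g h a : @tri_elim U f g h (tlo a) = f a.
Proof. by []. Qed.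

Lemma tri_elim_mid U f g h a : @tri_elim U f g h (tmid a) = g a.
Proof. by []. Qed.

Lemma tri_elim_up U f g h a : @tri_elim U f g h (tup a) = h a.
Proof. by []. Qed.

Definition tri_elimE := (tri_elim_lo, tri_elim_mid, tri_elim_up).

Lemma lt_tlo a b : (tlo a < tlo b) = (a < b).
Proof. by rewrite /tlo !lt_lsum_same. Qed.

Lemma lt_tmid a b : (tmid a < tmid b) = (a < b).
Proof. by rewrite /tmid !lt_lsum_same. Qed.

Lemma lt_tup a b : (tup a < tup b) = (a < b).
Proof. by rewrite /tup !lt_lsum_same. Qed.

Lemma tlo_lt_mid a b : tlo a < tmid b.
Proof. by rewrite /tlo /tmid lt_lsum_same; exact: lt_lsum_tag. Qed.

Lemma tlo_lt_up a b : tlo a < tup b.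
Proof. exact: lt_lsum_tag. Qed.

Lemma tmid_lt_up a b : tmid a < tup b.
Proof. exact: lt_lsum_tag. Qed.

Lemma tmid_lt_lo a b : (tmid a < tlo b) = false.
Proof. by rewrite ltNge (ltW (tlo_lt_mid _ _)). Qed.

Lemma tup_lt_lo a b : (tup a < tlo b) = false.
Proof. by rewrite ltNge (ltW (tlo_lt_up _ _)). Qed.

Lemma tup_lt_mid a b : (tup a < tmid b) = false.
Proof. by rewrite ltNge (ltW (tmid_lt_up _ _)). Qed.

Definition lt_triE := (lt_tlo, lt_tmid, lt_tup, tlo_lt_mid, tlo_lt_up,
  tmid_lt_up, tmid_lt_lo, tup_lt_lo, tup_lt_mid).

(** The whole middle summand is sent to [x], which belongs to both halves of [X]; hence [Mid] may be
    any order. *)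
Lemma cov_tri {d'} {T : orderType d'} (X : set T) (x : T) :
  X x -> covers [set: Lo] (X `&` [set y | y <= x]) ->
  covers [set: Up] (X `&` [set y | x <= y]) -> covers [set: tri] X.
Proof.
move=> Xx [f [fm fX fs]] [h [hm hX hs]].
exists (tri_elim f (fun=> x) h); split.
- move=> w1 w2 _ _; rewrite leNgt.
  case: (triP w1) => a; case: (triP w2) => b; rewrite lt_triE ?tri_elimE //.
  + by rewrite -leNgt; exact: fm.
  + by have [] := fX a Logic.I.
  + move=> _; apply: (le_trans (y := x)); first by have [] := fX a Logic.I.
    by have [] := hX b Logic.I.
  + by have [] := hX b Logic.I.
  + by rewrite -leNgt; exact: hm.
- move=> w _; case: (triP w) => a; rewrite tri_elimE //.
    by have [] := fX a Logic.I.
  by have [] := hX a Logic.I.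
- move=> y Xy; have /orP[yx|xy] := le_total y x.
    by have [|a _ <-] := fs y; [split|exists (tlo a)].
  by have [|a _ <-] := hs y; [split|exists (tup a)].
Qed.

End ThreeSummands.


(** * Countability, and the properties carried by the induction *)

Lemma ctbl_sigT (I : Type) (L : I -> Type) :
  ctbl I -> (forall i, ctbl (L i)) -> ctbl {i : I & L i}.
Proof.
move=> [f fI] cL; pose g i := sval (cid (cL i)).
exists (fun s => pickle (f (tag s), g _ (tagged s))).
move=> [i a] [j b] /(pcan_inj pickleK) /= [/fI ij]; subst j.
by move=> /(svalP (cid (cL i))) ->.
Qed.

Lemma ctbl_countType (T : countType) : ctbl T.
Proof. by exists pickle; exact: pcan_inj pickleK. Qed.

Lemma ctbl_ladd {d} (L K : orderType d) : ctbl L -> ctbl K -> ctbl (ladd L K).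
Proof. by move=> cL cK; apply: ctbl_sigT => [|[]//]; exact: ctbl_countType. Qed.

Lemma ctbl_lmul {d1 d2} (L : orderType d2) (K : orderType d1) :
  ctbl L -> ctbl K -> ctbl (lmul L K).
Proof. by move=> cL cK; exact: ctbl_sigT. Qed.

(** This says that the sum of two copies of [N] embeds into [M]. *)
Definition embeds_twice {d1 d2} (N : orderType d1) (M : orderType d2) :=
  exists f0 f1 : N -> M, [/\ {homo f0 : a b / a < b}, {homo f1 : a b / a < b} &
    forall a b, f0 a < f1 b].

(** The strictly decreasing self-map is an embedding of [N] into its reverse; at limits it lets the
    reversed half of an interval be embedded. *)
Record tame {d} (N : orderType d) : Prop := Tame {
  tame_inhabited : inhabited N;
  tame_ctbl : ctbl N;
  tame_dual : exists f : N -> N, forall a b, a < b -> f b < f a;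
  tame_ssurj : ssurj N }.

Lemma cov_lmul_tag {d1 d2} (L : orderType d2) (K : orderType d1) (k : K) :
  covers [set s : lmul L K | tag s = k] [set: L].
Proof.
exists (fun s => tagged s); split=> //.
  by move=> [i a] [j b] /= -> ->; rewrite le_lsum_same.
by move=> y _; exists (existT _ k y).
Qed.

(** * Successor exponents *)

Section Successor.
Context (N : linorder) (gN : tame N).

Let Lo : linorder := lmul N (nat^d : orderType _).
Let Up : linorder := lmul N nat.
Let W : linorder := zpow_succ N.

(** The copies of [N] in [W] are indexed by the integers, the middle one by 0. [up_part] and
    [lo_part] are the positive and negative parts of this index, and [coord] is the position within
    the copy. *)
Let up_part (w : W) : nat :=
  tri_elim (fun=> 0%N) (fun=> 0%N) (fun s : Up => (tag s).+1) w.
Let lo_part (w : W) : nat :=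
  tri_elim (fun s : Lo => (tag s : nat).+1) (fun=> 0%N) (fun=> 0%N) w.
Let coord (w : W) : N :=
  tri_elim (fun s : Lo => tagged s) id (fun s : Up => tagged s) w.

Let partsP (a b : W) : a <= b ->
  (up_part a <= up_part b)%N /\ (lo_part b <= lo_part a)%N.
Proof.
rewrite leNgt /up_part /lo_part.
case: (triP a) => s; case: (triP b) => t; rewrite lt_triE ?tri_elimE //= -leNgt.
  by move=> /le_lsum_tag.
by move=> /le_lsum_tag.
Qed.

Let coordP (a b : W) : a < b ->
  up_part a = up_part b -> lo_part a = lo_part b -> coord a < coord b.
Proof.
rewrite /up_part /lo_part /coord.
case: (triP a) => s; case: (triP b) => t; rewrite lt_triE ?tri_elimE //=.
- move=> /lt_lsumP[|[i [x [y [-> -> //]]]]].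
  by move=> + _ [ij]; rewrite ij ltxx.
- move=> /lt_lsumP[|[i [x [y [-> -> //]]]]].
  by move=> + [ij]; rewrite ij ltxx.
Qed.

Let ctblW : ctbl W.
Proof.
have cN := tame_ctbl gN.
apply: ctbl_ladd; [apply: ctbl_ladd|] => //; apply: ctbl_lmul => //.
  exact: ctbl_countType.
exact: ctbl_countType.
Qed.

(* In [r], the truncated term counts the copies below the middle one from that
   of [x] on; it is faithful because only points above [x] are considered. *)
Let cov_up (X : set W) (x : W) :
  X x -> covers [set: Up] (X `&` [set y | x <= y]).
Proof.
move=> Xx; set r := fun w => (up_part w + (lo_part x - lo_part w))%N.
apply: (@cov_half_succ _ _ _ Up N W (@tag _ _) _ x r) => //.
- exact: tame_ssurj.
- by move=> a b /le_lsum_tag.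
- exact: cov_lmul_tag.
- by split=> /=.
- by move=> y [].
- by move=> a b _ _ /partsP[]; rewrite /r; lia.
- move=> s; exists coord => a b [[Xa /= /partsP xa] ra] [[Xb /= /partsP xb] rb].
  move=> ab; have := partsP (ltW ab); move: xa xb ra rb; rewrite /r /= => *.
  by apply: coordP => //; lia.
Qed.

(** Mirror image of [cov_up]: in the reversed order the copies in [Lo] are numbered increasingly
    from the middle outwards. The truncated term now counts copies above the middle one, for points
    below [x]. *)
Let cov_lo (X : set W) (x : W) :
  X x -> covers [set: Lo] (X `&` [set y | y <= x]).
Proof.
move=> Xx; set r := fun w => (lo_part w + (up_part x - up_part w))%N.
apply: cov_reverse.
apply: (@cov_half_succ _ _ _ (lreverse Lo) (lreverse N) (lreverse W)
  (fun s => tag (s : Lo)) _ x r) => //.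
- exact/ssurj_reverse/tame_ssurj.
- by move=> a b /le_lsum_tag.
- by move=> k; apply: reverse_cov; exact: cov_lmul_tag.
- by split=> //=.
- by move=> y [].
- by move=> a b _ _ /partsP[]; rewrite /r; lia.
- move=> s; apply: embeds_on_reverse.
  exists coord => a b [[Xa /= /partsP xa] ra] [[Xb /= /partsP xb] rb].
  move=> ab; have := partsP (ltW ab); move: xa xb ra rb; rewrite /r /= => *.
  by apply: coordP => //; lia.
Qed.

Lemma tame_zpow_succ : tame (zpow_succ N).
Proof.
split=> //.
- by have [z] := tame_inhabited gN; exact: (inhabits (tmid _ _ z)).
- have [f fP] := tame_dual gN.
  (* The decreasing map swaps the two halves, keeps the copy number, and acts by [f] inside each
     copy. *)
  exists (tri_elim
    (fun s : Lo => tup _ _ (existT _ (tag s : nat) (f (tagged s))))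
    (fun z => tmid _ _ (f z))
    (fun s : Up => tlo _ _ (existT _ (tag s : nat^d) (f (tagged s))))) => a b.
  case: (triP a) => s; case: (triP b) => t; rewrite ?tri_elimE !lt_triE //.
  + move=> /lt_lsumP[|[i [x [y [-> -> xy]]]]].
      by rewrite ?ltEdual => st; apply: lt_lsum_tag.
    by rewrite lt_lsum_same /=; exact: fP.
  + exact: fP.
  + move=> /lt_lsumP[|[i [x [y [-> -> xy]]]]].
      by rewrite ?ltEdual => st; apply: lt_lsum_tag.
    by rewrite lt_lsum_same /=; exact: fP.
- move=> X [x Xx]; apply: (@cov_tri _ Lo N Up _ W X x) => //.
    exact: cov_lo.
  exact: cov_up.
Qed.

End Successor.

Lemma embeds_twice_zpow_succ (N : linorder) : embeds_twice N (zpow_succ N).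
Proof.
exists (fun z => tmid _ _ z), (fun z => tup _ _ (existT _ 0%N z)).
split=> [a b ab|a b ab|a b]; rewrite ?lt_triE //.
by rewrite lt_lsum_same.
Qed.

(** * Limit exponents *)

Section Limit.
Context {d : Order.disp_t} (A : orderType d) (Z : A -> linorder).
Hypotheses (a0 : A) (cA : ctbl A) (noM : forall y : A, exists y', y < y').
Hypotheses (gZ : forall y, tame (Z y))
  (dZ : forall y y', y < y' -> embeds_twice (Z y) (Z y'))
  (qZ : forall y, embeds_on [set s : Qsum Z | tag s < y] (Z y)).

Let W : linorder := zpow_lim Z.

Let level (y : A) (w : W) : Prop :=
  tri_elim (fun s : lreverse (Qsum Z) => tag (s : Qsum Z) < y : Prop)
    (fun=> True) (fun s : Qsum Z => tag s < y : Prop) w.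

(** Each half of the set embeds into [Z y], the lower one after a reversal by [g]. Doubling twice
    gives room for three consecutive pieces in [Z y'']: lower half, centre, upper half. *)
Let level_emb y : exists y', embeds_on [set w | level y w] (Z y').
Proof.
have [y' yy'] := noM y; have [y'' yy''] := noM y'.
have [f fP] := qZ y; have [g gP] := tame_dual (gZ y).
have [f0 [f1 [f0P f1P f01]]] := dZ yy'.
have [h0 [h1 [h0P h1P h01]]] := dZ yy''.
have [z0] := tame_inhabited (gZ y).
exists y'', (tri_elim (fun s : lreverse (Qsum Z) => h0 (f0 (g (f s))))
  (fun=> h0 (f1 z0)) (fun s : Qsum Z => h1 (f0 (f s)))) => a b /=.
rewrite /level.
case: (triP a) => s; case: (triP b) => t; rewrite ?tri_elimE !lt_triE //.
- by move=> sy ty; rewrite ltr_reverse => ts; apply/h0P/f0P/gP; exact: fP.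
- by move=> _ _ _; apply: h0P.
- by rewrite (ord1 s) (ord1 t) ltxx.
- by move=> sy ty st; apply/h1P/f0P; exact: fP.
Qed.

(** In both halves the index grows away from the centre, so a non-central point between [a] and [b]
    has index at most that of the endpoint on its side. *)
Let bounded_emb (a b : W) : exists y, embeds_on [set w | a <= w <= b] (Z y).
Proof.
have lev w : exists y, level y w.
  case: (triP w) => s; last by have [y] := noM (tag s); exists y.
    by have [y] := noM (tag (s : Qsum Z)); exists y.
  by exists a0.
have [ya la] := lev a; have [yb lb] := lev b.
have [y yP] := level_emb (Order.max ya yb); exists y.
apply: embeds_on_sub yP => w /= /andP[]; rewrite !leNgt.
move: la lb; rewrite /level.
case: (triP a) => s; case: (triP b) => t; case: (triP w) => u;
  rewrite ?tri_elimE ?lt_triE //= ?ltr_reverse -?leNgt lt_max => sy ty au ub.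
all: try by rewrite (le_lt_trans (le_lsum_tag au) sy).
all: by rewrite (le_lt_trans (le_lsum_tag ub) ty) orbT.
Qed.

Let ctblW : ctbl W.
Proof.
have cQ : ctbl (Qsum Z).
  apply: ctbl_sigT => // y; apply: ctbl_lmul; last exact: ctbl_countType.
  exact: tame_ctbl.
by apply: ctbl_ladd => //; apply: ctbl_ladd => //; exact: ctbl_countType.
Qed.

Let embZ y y' : y < y' -> embeds_on [set: Z y] (Z y').
Proof. by move=> /dZ[f0 [_ [f0P _ _]]]; exists f0 => a b _ _; exact: f0P. Qed.

Lemma tame_zpow_lim : tame (zpow_lim Z).
Proof.
split=> //.
- exact: (inhabits (tmid _ _ ord0)).
- exists (tri_elim (fun s : lreverse (Qsum Z) => tup _ _ (s : Qsum Z))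
    (fun z => tmid _ _ z)
    (fun s : Qsum Z => tlo _ _ (s : lreverse (Qsum Z)))) => a b.
  case: (triP a) => s; case: (triP b) => t; rewrite ?tri_elimE !lt_triE //.
  + by rewrite ltr_reverse.
  + by rewrite (ord1 s) (ord1 t) ltxx.
  + by rewrite ltr_reverse.
- move=> X [x Xx].
  apply: (@cov_tri _ (lreverse (Qsum Z)) 'I_1 (Qsum Z) _ W X x) => //.
  (* The lower half is covered inside the reverse of [W]. A reversed interval embeds into [Z y] by
     composing with the decreasing map of [Z y]. *)
  + have [g [gm gX gs]] : covers [set: Qsum Z]
      (X `&` [set y | y <= x] : set (lreverse W)).
      apply: (@cov_half_lim _ _ A Z (lreverse W) _ x) => //.
      * by move=> y; exact: tame_ssurj.
      * by split=> /=.
      * by move=> y [].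
      * move=> a b _ _; have [y [f fP]] := bounded_emb b a.
        have [g gP] := tame_dual (gZ y).
        exists y, (g \o f) => u v [_ /= /andP[au ub]] [_ /= /andP[av vb]].
        rewrite ltr_reverse => vu; apply: gP; apply: fP => //=.
          exact/andP.
        exact/andP.
    by exists g; split=> // a b Da Db ab; exact: gm.
  + apply: (@cov_half_lim _ _ A Z W _ x) => //.
    * by move=> y; exact: tame_ssurj.
    * by split=> /=.
    * by move=> y [].
    * move=> a b _ _; have [y yP] := bounded_emb a b; exists y.
      by apply: embeds_on_sub yP => u [].
Qed.

End Limit.

Lemma tame_unit : tame ('I_1 : linorder).
Proof.
split.
- exact: (inhabits ord0).
- exact: ctbl_countType.
- by exists id => a b; rewrite (ord1 a) (ord1 b) ltxx.
- move=> X [x Xx]; exists id; split=> // [a _|y _]; last by exists y.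
  by rewrite (ord1 a) -(ord1 x).
Qed.

(** * One step of the recursion *)

Section Step.
Context {d : Order.disp_t} (A : orderType d) (Z : A -> linorder).
Hypotheses (cA : ctbl A) (gZ : forall y, tame (Z y))
  (dZ : forall y y', y < y' -> embeds_twice (Z y) (Z y'))
  (qZ : forall y, embeds_on [set s : Qsum Z | tag s < y] (Z y)).

Let step_spec (W : linorder) :=
  [/\ tame W, forall y, embeds_twice (Z y) W & embeds_on [set: Qsum Z] W].

Let spec_succ (m : A) : is_max m -> step_spec (zpow_succ (Z m)).
Proof.
move=> mP.
have eZ y : exists e : Z y -> Z m, {homo e : a b / a < b}.
  have := mP y; rewrite le_eqVlt => /orP[/eqP ym|/dZ].
    by move: ym (mP y) => -> _; exists id.
  by move=> [f [_ [fP _ _]]]; exists f.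
split; first exact/tame_zpow_succ/gZ.
  move=> y; have [e eP] := eZ y.
  have [f0 [f1 [f0P f1P f01]]] := embeds_twice_zpow_succ (Z m).
  exists (f0 \o e), (f1 \o e); split=> [a b ab|a b ab|a b] //=.
    exact/f0P/eP.
  exact/f1P/eP.
pose e y := sval (cid (eZ y)).
have eP y : {homo e y : a b / a < b} := svalP (cid (eZ y)).
have [f fP] := qZ m.
(* Summands of index below [m] go to the middle copy by [qZ]; the copies of [Z m] go to the upper
   half. Having [e] at every index avoids a transport along [tag s = m]. *)
exists (fun s : Qsum Z => if tag s < m then tmid _ _ (f s)
  else tup _ _ (existT _ (tag (tagged s)) (e _ (tagged (tagged s)))))
  => s t _ _ st.
have := le_lsum_tag (ltW st); have [sm|ms] := ltP (tag s) m; last first.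
  move=> /(le_trans ms) mt; rewrite [tag t < m]ltNge mt /= lt_triE.
  case: (lt_lsumP st) => [|[y [a [b [-> -> ab]]]]].
    by move=> lt_st; have := lt_le_trans lt_st (mP _); rewrite ltNge ms.
  case: (lt_lsumP ab) => [ij|[i [u [v [-> -> uv]]]]] /=.
    exact: lt_lsum_tag.
  by rewrite lt_lsum_same; exact: eP.
by case: (ltP (tag t) m) => [tm|mt] _; rewrite lt_triE //; exact: fP.
Qed.

Let spec_lim : A -> (forall m : A, ~ is_max m) -> step_spec (zpow_lim Z).
Proof.
move=> a0 noM.
have {}noM y : exists y' : A, y < y'.
  apply: contrapT => no; apply: (noM y) => y'; rewrite leNgt.
  by apply/negP => yy'; apply: no; exists y'.
split; first exact: tame_zpow_lim.
  move=> y; exists (fun z => tup _ _ (existT _ y (existT _ 0%N z))),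
    (fun z => tup _ _ (existT _ y (existT _ 1%N z))).
  split=> [a b ab|a b ab|a b]; by rewrite lt_triE lt_lsum_same ?lt_lsum_same.
by exists (fun s => tup _ _ s) => s t _ _; rewrite lt_triE.
Qed.

(** The conclusions reproduce the hypotheses [gZ], [dZ] and [qZ] for the next power, which closes
    the induction. *)
Lemma zpow_stepP :
  [/\ tame (zpow_step Z), forall y, embeds_twice (Z y) (zpow_step Z) &
    embeds_on [set: Qsum Z] (zpow_step Z)].
Proof.
rewrite /zpow_step; case: pselect => [iA|nA].
  case: pselect => [exm|noM]; first by case: cid => m mP /=; exact: spec_succ.
  by have [a0] := iA; apply: spec_lim => // m mP; apply: noM; exists m.
split; first exact: tame_unit.
  by move=> y; case: nA.
by exists (fun=> ord0) => s; case: nA; exact: (inhabits (tag s)).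
Qed.

End Step.

(** * Well-founded induction on the exponent *)

Section Induction.
Context {d : Order.disp_t} (A : orderType d) (wfA : well_ordered A).
Hypothesis cA : ctbl A.

Notation zb := (zpow_below wfA).

Let IHspec (x : A) : Prop :=
  [/\ tame (zb x), forall y, y < x -> embeds_twice (zb y) (zb x) &
    embeds_on [set: Qsum (fun y : below x => zb (val y))] (zb x)].

(** Stated along [q] to serve both the segments [below x], with [q] the inclusion, and [A] itself,
    with [q] the identity. *)
Let emb_initial {d'} (B : orderType d') (q : B -> A) (y : B) :
  {homo q : a b / a < b} -> IHspec (q y) ->
  embeds_on [set s : Qsum (fun b => zb (q b)) | tag s < y] (zb (q y)).
Proof.
move=> qm [[[u0] _ _ _] _ [e eP]].
pose K (b : below (q y)) : linorder := lmul (zb (val b)) nat.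
(* Matching on [idP] supplies the proof that makes the index a point of [below (q y)]; [u0] is a
   default outside the set considered. *)
exists (fun s : Qsum (fun b => zb (q b)) => match @idP (q (tag s) < q y) with
  | ReflectT p => e (existT K (exist _ (q (tag s)) p : below (q y)) (tagged s))
  | ReflectF _ => u0 end) => s t /= sy ty st.
case: {-}_ / idP => [ps|]; last by rewrite qm.
case: {-}_ / idP => [pt|]; last by rewrite qm.
apply: eP => //.
case: (lt_lsumP st) ps pt => [|[i [a [b [-> -> ab]]]]] /=.
  by move=> + ps pt; move=> /qm qst; apply: lt_lsum_tag.
(* The two membership proofs agree, so both points lie in the same summand. *)
move=> ps pt; rewrite (bool_irrelevance ps pt) lt_lsum_same //.
Qed.

Lemma zpow_belowP x : IHspec x.
Proof.
elim/(well_founded_ind wfA): x => x IH; rewrite /IHspec zpow_belowE.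
have [||||g1 g2 g3] := @zpow_stepP _ (below x) (fun y => zb (val y)).
- have [f fI] := cA; exists (f \o val) => a b /fI; exact: val_inj.
- by move=> y; have [] := IH _ (valP y).
- by move=> y y' yy'; have [_ + _] := IH _ (valP y'); apply.
- by move=> y; apply: emb_initial => //; exact: IH (valP y).
split=> // y yx; exact: (g2 (exist _ y yx)).
Qed.

Lemma tame_zpow : tame (zpow wfA).
Proof.
have [|||| //] := @zpow_stepP _ A zb.
- exact: cA.
- by move=> y; have [] := zpow_belowP y.
- by move=> y y' yy'; have [_ + _] := zpow_belowP y'; apply.
- by move=> y; apply: (@emb_initial _ A id) => //; exact: zpow_belowP.
Qed.

End Induction.

(** The [m] copies serve as the blocks of the source and, pulled back along the embedding, as the
    fibres in [L], so that [cov_blocks] applies with [m = n + 1] and both offsets 0. *)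
Theorem proposition3p6 (d : Order.disp_t) (A : orderType d)
    (wfA : well_ordered A) (countA : countable [set: A])
    (m : nat) (m_gt0 : (0 < m)%N) :
  strongly_surjective (lmul (zpow wfA) 'I_m).
Proof.
have cA : ctbl A.
  have /countable_injP[f fI] := countA.
  by exists f => a b; apply: fI; rewrite inE.
have [_ _ _ sZ] := tame_zpow wfA cA.
move=> d' L [l0] [f finj fm].
have fP a b : a < b -> f a < f b.
  by rewrite !lt_neqAle => /andP[ab /fm ->]; rewrite andbT (inj_eq finj).
case: m m_gt0 f finj fm fP => // n _ f _ fm fP.
pose p (s : lmul (zpow wfA) 'I_n.+1) : nat := tag s.
have [||||||g [gm gL gs]] := @cov_blocks _ _ _
  (lmul (zpow wfA) 'I_n.+1) (zpow wfA) L p 0 n 0 [set: L] (p \o f) sZ.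
- by move=> a b ab; apply: lt_lsum_tag.
- move=> k kn; have -> : [set h | p h = k] = [set h | tag h = inord k].
    apply/seteqP; split=> h; rewrite /p /= => hk.
      by rewrite -hk inord_val.
    by rewrite hk inordK.
  exact: cov_lmul_tag.
- by exists l0.
- by move=> a b _ _ /fm /le_lsum_tag.
- by move=> a _ /=; rewrite add0n -ltnS ltn_ord.
- move=> s; exists (fun a => tagged (f a)) => a b [_ /= ra] [_ /= rb] /fP.
  case/lt_lsumP => [|[i [u [v [-> -> //]]]]].
  by rewrite ltEord -/(p _) -/(p (f b)) ra rb ltnn.
exists g => [a b ab|y]; last by have [a _ <-] := gs y Logic.I; exists a.
by apply: gm => //=; rewrite add0n -ltnS ltn_ord.
Qed.
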